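(* Let $V$ be a superspace and let $a(w),b(w)$ be $\mathrm{End}(V)$-valued fields. For $j\in\mathbb{Z}$ define the generalized $j$-product $$a(w)_{(j)}b(w)=\mathrm{Res}_z\left(i_{z,w}(z-w)^j\,a(z)b(w)-i_{w,z}(z-w)^j\,p(a,b)\,b(w)a(z)\right).$$ Then for every integer $j\ge0$, $$a(w)_{(j)}b(w)=\mathrm{Res}_z(z-w)^j[a(z),b(w)]\qquad\text{and}\qquad a(w)_{(-1-j)}b(w)=\frac{:(\partial_w^ja(w))b(w):}{j!}.$$
   Context: All vector spaces are over $\mathbb{C}$. $\mathrm{End}(V)$ is an associative superalgebra with superbracket $[x,y]=xy-p(x,y)yx$, $p(x,y)=(-1)^{p(x)p(y)}$. A formal distribution $a(z)=\sum_{n\in\mathbb{Z}}a_{(n)}z^{-n-1}$ has all modes of the same parity, which is its parity; it is an $\mathrm{End}(V)$-valued field if $a(z)v\in V[[z]][z^{-1}]$ for all $v\in V$. $\mathrm{Res}_z$ is the coefficient of $z^{-1}$. $i_{z,w}(z-w)^k=\sum_{j\ge0}\binom kj(-w)^jz^{k-j}$ and $i_{w,z}(z-w)^k=\sum_{j\ge0}\binom kjz^j(-w)^{k-j}$ for $k\in\mathbb{Z}$, with $\binom kj=k(k-1)\cdots(k-j+1)/j!$. With $a(z)_+=\sum_{n\le-1}a_{(n)}z^{-n-1}$ and $a(z)_-=\sum_{n\ge0}a_{(n)}z^{-n-1}$, the normal product is $:a(w)b(w):=a(w)_+b(w)+p(a,b)b(w)a(w)_-$. *)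

(* Defs.v *)
From HB Require Import structures.
From mathcomp Require Import all_boot all_order all_algebra.
From mathcomp Require Import complex.
From mathcomp Require Import mathcomp_extra boolp classical_sets functions
  cardinality fsbigop.
From mathcomp Require Import reals zify.
Set Implicit Arguments.
Unset Strict Implicit.
Unset Printing Implicit Defensive.
Import GRing.Theory.
Local Open Scope classical_set_scope.
Local Open Scope ring_scope.

(* Conventions.
   - A parity is a boolean ([false] is even, [true] is odd); parities are added
     with [addb].
   - A series in z with coefficients in M is the function [A : int -> M] whose
     value at m is the coefficient of z^m; for two variables, [A m n] is the
     coefficient of z^m w^n.  Hence the mode a_(n) of a formal distribution is
     [a (- n - 1)], and n <= -1 (resp. n >= 0) means that the exponent of z is
     >= 0 (resp. < 0). *)

Record super_grading (K : fieldType) (V : lmodType K) := SuperGrading {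
  piece : bool -> {pred V};
  piece_submod : forall p, submod_closed (piece p);
  piece_decomp : forall v, exists! u : V * V,
    [/\ u.1 \in piece false, u.2 \in piece true & v = u.1 + u.2] }.

Definition End (K : fieldType) (V : lmodType K) := {linear V -> V}.

Section EndAlgebra.
Context (K : fieldType) (V : lmodType K).
Implicit Types f g h : End V.

HB.instance Definition _ := gen_eqMixin (End V).
HB.instance Definition _ := gen_choiceMixin (End V).

Lemma EndP f g : (forall v, f v = g v) <-> f = g.
Proof.
split=> [fg|->//]; have /funext fgE := fg; clear fg.
case: f g fgE => [f [[f1] [f2]]] [g [[g1] [g2]]] /= fgE; subst g.
by rewrite (Prop_irrelevance f1 g1) (Prop_irrelevance f2 g2).
Qed.

Definition End0 : End V := \0.
Definition End1 : End V := idfun.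
Definition End_opp f : End V := \- f.
Definition End_add f g : End V := f \+ g.
Definition End_mul f g : End V := f \o g.
Definition End_scale (c : K) f : End V := c \*: f.

Fact End_addA : associative End_add.
Proof. by move=> f g h; apply/EndP=> v /=; rewrite addrA. Qed.
Fact End_addC : commutative End_add.
Proof. by move=> f g; apply/EndP=> v /=; rewrite addrC. Qed.
Fact End_add0 : left_id End0 End_add.
Proof. by move=> f; apply/EndP=> v /=; rewrite add0r. Qed.
Fact End_addN : left_inverse End0 End_opp End_add.
Proof. by move=> f; apply/EndP=> v /=; rewrite addNr. Qed.
HB.instance Definition _ := GRing.isZmodule.Build (End V)
  End_addA End_addC End_add0 End_addN.

Fact End_mulA : associative End_mul.
Proof. by move=> f g h; apply/EndP. Qed.
Fact End_mul1l : left_id End1 End_mul.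
Proof. by move=> f; apply/EndP. Qed.
Fact End_mul1r : right_id End1 End_mul.
Proof. by move=> f; apply/EndP. Qed.
Fact End_mulDl : left_distributive End_mul End_add.
Proof. by move=> f g h; apply/EndP. Qed.
Fact End_mulDr : right_distributive End_mul End_add.
Proof. by move=> f g h; apply/EndP=> v /=; rewrite raddfD. Qed.
HB.instance Definition _ := GRing.Zmodule_isPzRing.Build (End V)
  End_mulA End_mul1l End_mul1r End_mulDl End_mulDr.

Fact End_scaleA c d f : End_scale c (End_scale d f) = End_scale (c * d) f.
Proof. by apply/EndP=> v /=; rewrite scalerA. Qed.
Fact End_scale1 : left_id 1 End_scale.
Proof. by move=> f; apply/EndP=> v /=; rewrite scale1r. Qed.
Fact End_scaleDr : right_distributive End_scale +%R.
Proof. by move=> c f g; apply/EndP=> v /=; rewrite scalerDr. Qed.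
Fact End_scaleDl f : {morph End_scale^~ f : c d / c + d}.
Proof. by move=> c d; apply/EndP=> v /=; rewrite scalerDl. Qed.
HB.instance Definition _ := GRing.Zmodule_isLmodule.Build K (End V)
  End_scaleA End_scale1 End_scaleDr End_scaleDl.

End EndAlgebra.

Section LocallyFiniteSum.
Context (K : fieldType) (V : lmodType K) (I : choiceType).
Implicit Types F : I -> End V.

Definition loc_finite F := forall v, finite_set [set i | F i v != 0].

(* The test on [loc_finite] is there because a sum with infinite support is 0
   for [\sum_(i \in _)], so that the pointwise sum is linear only for locally
   finite families. *)
Definition lfsum_fun F (v : V) : V :=
  if `[< loc_finite F >] then \sum_(i \in setT) F i v else 0.

Fact lfsum_linear F : linear (lfsum_fun F).
Proof.
move=> c u v; rewrite /lfsum_fun; case: asboolP => [finF|_]; last first.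
  by rewrite scaler0 addr0.
pose D := [set i | F i u != 0] `|` [set i | F i v != 0].
have finD : finite_set D by rewrite finite_setU; split; exact: finF.
have D0 i : ~ D i -> F i u = 0 /\ F i v = 0.
  by move=> /not_orP[/negP/negPn/eqP ? /negP/negPn/eqP].
have sumD w : (forall i, ~ D i -> F i w = 0) ->
    \sum_(i \in setT) F i w = \sum_(i \in D) F i w.
  by move=> w0; apply/esym/fsbig_widen => // i [_ /w0].
rewrite (sumD u) => [|i /D0[]//]; rewrite (sumD v) => [|i /D0[]//].
rewrite sumD => [|i /D0[u0 v0]]; last by rewrite linearP /= u0 v0 scaler0 addr0.
rewrite !fsbig_finite //= scaler_sumr -big_split /=.
by apply: eq_bigr => i _; rewrite linearP.
Qed.
HB.instance Definition _ F :=
  GRing.isLinear.Build K V V *:%R (lfsum_fun F) (lfsum_linear F).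

Definition lfsum F : End V := lfsum_fun F.

Lemma lfsumE F v : loc_finite F -> lfsum F v = \sum_(i \in setT) F i v.
Proof. by move=> finF; rewrite /= /lfsum_fun asboolT. Qed.

End LocallyFiniteSum.

Section ScalarSeries.
Context (K : fieldType).

Definition binz (k : int) (j : nat) : K :=
  (\prod_(i < j) (k - i%:Z)%:~R) / j`!%:R.

(* i_{z,w} (z - w)^k: the power of w is j and the power of z is k - j *)
Definition izw (k : int) (p q : int) : K :=
  if q is Posz j then
    if p == k - j%:Z then binz k j * (- 1) ^+ j else 0
  else 0.

(* i_{w,z} (z - w)^k: the power of z is j and the power of w is k - j *)
Definition iwz (k : int) (p q : int) : K :=
  if p is Posz j then
    if q == k - j%:Z then binz k j * (- 1) ^ (k - j%:Z) else 0
  else 0.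

(* In {poly {poly K}} the outer variable 'X is z and 'X%:P is w *)
Definition zBw : {poly {poly K}} := 'X - 'X%:P.

Definition series_of_poly (P : {poly {poly K}}) (p q : int) : K :=
  if p is Posz m then if q is Posz n then P`_m`_n else 0 else 0.

End ScalarSeries.

Section FormalDistributions.
Context (K : fieldType) (V : lmodType K) (G : super_grading V).

Definition homogeneous (p : bool) (f : End V) :=
  forall r v, v \in piece G r -> f v \in piece G (r (+) p).

(* As 0 is homogeneous of both parities, the parity is part of the data. *)
Record fdist := FDist {
  coeff :> int -> End V;
  parity : bool;
  coeff_homogeneous : forall m, homogeneous parity (coeff m) }.

Definition is_field (a : fdist) :=
  forall v, exists N : int, forall m, m < N -> a m v = 0.

Definition koszul (p q : bool) : K := (- 1) ^+ (p && q).

Definition sbracket (p q : bool) (f g : End V) : End V :=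
  f * g - koszul p q *: (g * f).

Definition res (A : int -> int -> End V) : int -> End V := A (- 1).

(* f(z,w) A(z,w) *)
Definition smul (f : int -> int -> K) (A : int -> int -> End V) :
    int -> int -> End V :=
  fun m n => lfsum (fun r : int * int => f r.1 r.2 *: A (m - r.1) (n - r.2)).

(* A(w) B(w) *)
Definition dmul (A B : int -> End V) : int -> End V :=
  fun m => lfsum (fun k : int => A k * B (m - k)).

(* a(z) b(w), b(w) a(z) and [a(z), b(w)] *)
Definition prod_zw (a b : fdist) : int -> int -> End V := fun m n => a m * b n.
Definition prod_wz (b a : fdist) : int -> int -> End V := fun m n => b n * a m.
Definition bracket_zw (a b : fdist) : int -> int -> End V :=
  fun m n => sbracket (parity a) (parity b) (a m) (b n).

Definition jprod (a : fdist) (j : int) (b : fdist) : int -> End V :=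
  res (smul (izw K j) (prod_zw a b)
       - smul (iwz K j) (koszul (parity a) (parity b) *: prod_wz b a)).

Definition plus_part (a : fdist) : int -> End V :=
  fun m => if 0 <= m then a m else 0.
Definition minus_part (a : fdist) : int -> End V :=
  fun m => if m < 0 then a m else 0.

Definition nprod (a b : fdist) : int -> End V :=
  dmul (plus_part a) b
  + koszul (parity a) (parity b) *: dmul b (minus_part a).

Fact deriv_homogeneous (a : fdist) (m : int) :
  homogeneous (parity a) ((m + 1)%:~R *: a (m + 1)).
Proof.
move=> r v vr; have [G0 GP] := piece_submod G (r (+) parity a).
rewrite /= -[X in X \in _]addr0; apply: GP => //.
exact: coeff_homogeneous.
Qed.

Definition fderiv (a : fdist) : fdist := FDist (deriv_homogeneous a).

End FormalDistributions.

(* For fields, every family summed by [jprod], [nprod] and by the product with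
   a polynomial in z, w is locally finite, so the default of [lfsum] is not
   used. *)
Section LocalFiniteness.
Context (K : fieldType) (V : lmodType K) (G : super_grading V) (a b : fdist G).

Let loc_finite_nat (I : choiceType) (F : I -> End V) :
    (forall v, exists (N : nat) (g : nat -> I), forall i, F i v != 0 ->
      exists2 q, (q < N)%N & g q = i) ->
  loc_finite F.
Proof.
move=> FN v; have [N [g gN]] := FN v.
apply: (@sub_finite_set _ _ (g @` `I_N)); last exact/finite_image/finite_II.
by move=> i /= /gN[q qN <-]; exists q.
Qed.

Fact izw_loc_finite (k m n : int) : is_field b ->
  loc_finite (fun r : int * int =>
    izw K k r.1 r.2 *: prod_zw a b (m - r.1) (n - r.2)).
Proof.
move=> fb; apply: loc_finite_nat => v; have [N bN] := fb v.
exists (absz (n - N)).+1, (fun i => (k - i%:Z, i%:Z)).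
move=> [p [q|q]] /=; last by rewrite scale0r eqxx.
case: (p =P k - q%:Z) => [->|_]; last by rewrite scale0r eqxx.
move=> h; exists q => //; rewrite ltnNge; apply/negP => le.
by move/negP: h; apply; rewrite bN ?raddf0 ?scaler0 //; lia.
Qed.

Fact iwz_loc_finite (k m n : int) (c : K) : is_field a ->
  loc_finite (fun r : int * int =>
    iwz K k r.1 r.2 *: (c *: prod_wz b a) (m - r.1) (n - r.2)).
Proof.
move=> fa; apply: loc_finite_nat => v; have [N aN] := fa v.
exists (absz (m - N)).+1, (fun i => (i%:Z, k - i%:Z)).
move=> [[p|p] q] /=; last by rewrite scale0r eqxx.
case: (q =P k - p%:Z) => [->|_]; last by rewrite scale0r eqxx.
rewrite -[X in _ *: X]/(c *: b (n - (k - p%:Z)) (a (m - p%:Z) v)).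
move=> h; exists p => //; rewrite ltnNge; apply/negP => le.
by move/negP: h; apply; rewrite aN ?raddf0 ?scaler0 //; lia.
Qed.

Fact poly_loc_finite (P : {poly {poly K}}) (A : int -> int -> End V) (m n : int) :
  loc_finite (fun r : int * int =>
    series_of_poly P r.1 r.2 *: A (m - r.1) (n - r.2)).
Proof.
move=> v; pose N := \max_(i < size P) size (P`_i)%R.
apply: (@sub_finite_set _ _
    ((fun r : nat * nat => (r.1%:Z, r.2%:Z)) @` (`I_(size P) `*` `I_N))).
  move=> [[p|p] [q|q]] /=; rewrite ?scale0r ?eqxx // => h.
  have [sp|sp] := leqP (size P) p.
    by rewrite (nth_default 0 sp) coef0 scale0r eqxx in h.
  have [sq|sq] := leqP (size (P`_p)%R) q.
    by rewrite (nth_default 0 sq) scale0r eqxx in h.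
  exists (p, q) => //=; split => //=; apply: (leq_trans sq).
  exact: (leq_bigmax (Ordinal sp)).
by apply: finite_image; apply: finite_setX; exact: finite_II.
Qed.

Fact plus_loc_finite (m : int) : is_field b ->
  loc_finite (fun k : int => plus_part a k * b (m - k)).
Proof.
move=> fb; apply: loc_finite_nat => v; have [N bN] := fb v.
exists (absz (m - N)).+1, (fun i => i%:Z).
move=> [q|q] /=; rewrite /plus_part /=; last by rewrite eqxx.
move=> h; exists q => //; rewrite ltnNge; apply/negP => le.
by move/negP: h; apply; rewrite bN ?raddf0 //; lia.
Qed.

Fact minus_loc_finite (m : int) : is_field a ->
  loc_finite (fun k : int => b k * minus_part a (m - k)).
Proof.
move=> fa; apply: loc_finite_nat => v; have [N aN] := fa v.
exists (absz N).+1, (fun i => m + i%:Z).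
move=> q /=; rewrite /minus_part; case: ifP => hm /=; last by rewrite raddf0 eqxx.
move=> h; exists (absz (q - m)); last by lia.
rewrite ltnNge; apply/negP => le.
by move/negP: h; apply; rewrite aN ?raddf0 //; lia.
Qed.

End LocalFiniteness.

(* Main.v *)
Require Import Defs.
From mathcomp Require Import all_boot all_order all_algebra.
From mathcomp Require Import complex.
From mathcomp Require Import boolp classical_sets functions reals.
From mathcomp Require Import cardinality fsbigop zify ring.
Import GRing.Theory.
Local Open Scope ring_scope.

(** Both identities are comparisons of coefficients.

    For an exponent j >= 0 the two expansions of (z - w)^j are the same
    polynomial ([izw_poly], [iwz_izw_nat]), so the two terms of the j-product
    combine into the residue of (z - w)^j times the superbracket.

    For the exponent -1-j, expanding in |z| > |w| and taking the residue in z
    turns i_{z,w} (z - w)^(-1-j) a(z) b(w) into the sum over i >= 0 of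
    binom(i+j,j) w^i a_i+j b(w), where a_m is the coefficient of z^m in a(z).
    This is Cauchy's formula: only nonnegative powers of z in a(z) contribute,
    and binom(m+j,j) a_m+j is the coefficient of w^m in the divided derivative
    of a(w), so the result is the product of the plus part of that derivative
    with b(w) ([dmul_plus_fderiv]). Expanding in |w| > |z| selects in the same
    way the negative powers of z, and yields the opposite of the product of
    b(w) with the minus part ([dmul_minus_fderiv]).

    The scalar content is the pair of reflection formulas [binzN_shift] and
    [binzN_reflect] for binomial coefficients with a negative upper entry. The
    rest is bookkeeping of locally finite sums: each expansion and each normal
    product is brought by [lfsum_reindex] to a sum over the naturals, where the
    terms can be compared one by one. *)

(** * Locally finite sums of endomorphisms *)

Section LocallyFiniteSums.
Local Open Scope classical_set_scope.
Context {K : fieldType} {V : lmodType K}.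

Lemma End_scaleAl (c : K) (f g : End V) : (c *: f) * g = c *: (f * g).
Proof. by apply/EndP. Qed.

Lemma End_scaleAr (c : K) (f g : End V) : f * (c *: g) = c *: (f * g).
Proof. by apply/EndP => v; exact: linearZ. Qed.

Lemma eq_lfsum (I : choiceType) (F F' : I -> End V) :
  F =1 F' -> lfsum F = lfsum F'.
Proof. by move=> /funext ->. Qed.

(** Scaling by a nonzero c preserves every support, hence also the divergent
    case; for c = 0 both sides vanish whether or not F is locally finite. *)
Lemma lfsumZ (I : choiceType) (c : K) (F : I -> End V) :
  lfsum (fun i => c *: F i) = c *: lfsum F.
Proof.
apply/EndP => v; rewrite -[RHS]/(c *: lfsum_fun F v) /= /lfsum_fun.
have ZE u i : (c *: F i) u = c *: F i u by [].
have [->|c0] := eqVneq c 0.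
  by rewrite scale0r; case: asboolP => // _; apply: fsbig1 => i _; exact: scale0r.
have finE : loc_finite (fun i => c *: F i) = loc_finite F.
  rewrite propeqE; split=> fin u; apply: sub_finite_set (fin u) => i /=;
    by rewrite ?ZE scaler_eq0 (negPf c0).
rewrite finE; case: asboolP => [fin|_]; last by rewrite scaler0.
pose D := [set i | F i v != 0]; have finD : finite_set D := fin v.
have D0 i : ([set: I] `\` D) i -> F i v = 0 by move=> [_ /negP/negPn/eqP].
rewrite -(fsbig_widen D) => // [|i /D0 Fv]; last first.
  by rewrite /= ?ZE Fv scaler0.
rewrite -(fsbig_widen D setT (fun i => F i v)) //.
by rewrite !fsbig_finite //= scaler_sumr.
Qed.

Lemma lfsumB (I : choiceType) (F F' : I -> End V) :
  loc_finite F -> loc_finite F' ->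
  lfsum (fun i => F i - F' i) = lfsum F - lfsum F'.
Proof.
move=> finF finF'.
apply/EndP => v; rewrite -[RHS]/(lfsum F v - lfsum F' v).
pose D u := [set i | F i u != 0] `|` [set i | F' i u != 0].
have finD u : finite_set (D u).
  by rewrite finite_setU; split; [exact: finF|exact: finF'].
have D0 u i : ~ D u i -> F i u = 0 /\ F' i u = 0.
  by move=> /not_orP[/negP/negPn/eqP ? /negP/negPn/eqP].
have BE u i : (F i - F' i) u = F i u - F' i u by [].
have finB : loc_finite (fun i => F i - F' i).
  move=> u; apply: sub_finite_set (finD u) => i; rewrite /= ?BE => B0.
  by apply: contrapT => /D0[f0 f'0]; rewrite f0 f'0 subr0 eqxx in B0.
rewrite !lfsumE //.
rewrite -(fsbig_widen (D v)) => // [|i [_ /D0[f0 f'0]]]; last first.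
  by rewrite /= ?BE f0 f'0 subr0.
rewrite -(fsbig_widen (D v) setT (fun i => F i v)) => // [|i [_ /D0[]]//].
rewrite -(fsbig_widen (D v) setT (fun i => F' i v)) => // [|i [_ /D0[]]//].
by rewrite !fsbig_finite //=; exact: sumrB.
Qed.

(** The supports of F and of F \o g are in bijection at every vector, so that
    the two families are locally finite together and have the same sum. *)
Lemma lfsum_reindex (I J : choiceType) (g : J -> I) (F : I -> End V) :
  injective g -> (forall i, (forall s, g s != i) -> F i = 0) ->
  lfsum F = lfsum (F \o g).
Proof.
move=> g_inj F0; apply/EndP => v; rewrite /= /lfsum_fun.
have F0v i : ~ range g i -> F i = 0.
  by move=> gi; apply: F0 => s; apply/eqP => gs; apply: gi; exists s.
have finE : loc_finite (F \o g) = loc_finite F.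
  rewrite propeqE; split=> fin u.
    apply: sub_finite_set (finite_image g (fin u)) => i /= Fi.
    have [s _ gs] : range g i.
      by apply: contrapT => /F0v Fi0; rewrite Fi0 eqxx in Fi.
    by exists s => //=; rewrite gs.
  by apply: (finite_preimage _ (fin u)) => s t _ _ /g_inj.
rewrite finE; case: asboolP => // _.
rewrite -(fsbig_widen (range g)) // => [|i [_ /F0v /= ->]//].
by rewrite fsbig_image // => s t _ _ /g_inj.
Qed.

End LocallyFiniteSums.

(** * Binomial expansions of powers of z - w *)

Section BinomialSeries.
Context {K : numFieldType}.

Lemma fact_neq0 n : n`!%:R != 0 :> K.
Proof. by rewrite Num.Theory.pnatr_eq0 -lt0n fact_gt0. Qed.

Lemma binz_bin (k i : nat) : binz K k%:Z i = 'C(k, i)%:R.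
Proof.
apply: (mulIf (fact_neq0 i)); rewrite /binz divfK ?fact_neq0 //.
rewrite -natrM bin_ffact ffact_prod; have [ik|ki] := leqP i k.
  rewrite natr_prod; apply: eq_bigr => s _.
  by rewrite [RHS]pmulrn -subzn // ltnW // (leq_trans (ltn_ord s)).
rewrite (bigD1 (Ordinal ki)) //= subrr mul0r.
by rewrite (bigD1 (Ordinal ki)) //= subnn mul0n.
Qed.

(** The product (-1-j)(-2-j)...(-i-j) is (-1)^i (i+j)!/j!. Multiplying by j!
    makes this an induction without quotients. *)
Lemma binzN_bin (j i : nat) :
  binz K (- 1 - j%:Z) i = (- 1) ^+ i * 'C(i + j, i)%:R.
Proof.
apply: (mulIf (fact_neq0 i)); rewrite /binz divfK ?fact_neq0 //.
apply: (mulIf (fact_neq0 j)).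
have := bin_fact (leq_addr j i); rewrite addKn => facE.
rewrite -!mulrA -!natrM facE {facE}.
elim: i => [|i IHi]; first by rewrite big_ord0 add0n.
rewrite big_ord_recr /= mulrAC IHi addSn factS natrM exprS.
have -> : (- 1 - j%:Z - i%:Z)%:~R = - (i + j).+1%:R :> K.
  by rewrite [in RHS]pmulrn -mulrNz; congr (_%:~R); lia.
by ring.
Qed.

(** As (z - w)^(-1-j) is the j-th divided derivative in w of (z - w)^(-1), which
    i_{z,w} expands as the sum of the w^i z^(-1-i), its coefficient at
    w^i z^(-1-j-i) comes from w^(i+j). *)
Lemma binzN_shift (j i : nat) :
  binz K (- 1 - j%:Z) i * (- 1) ^+ i = binz K (i%:Z + j%:Z) j.
Proof.
rewrite binzN_bin -PoszD binz_bin mulrAC -expr2 sqrr_sign mul1r.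
by rewrite -bin_sub ?leq_addr // addKn.
Qed.

(** The same for i_{w,z}, which expands (z - w)^(-1) as minus the sum of the
    z^i w^(-1-i): here it is w^(-1-i) that is differentiated j times. *)
Lemma binzN_reflect (j i : nat) :
  binz K (- 1 - j%:Z) i * (- 1) ^ (- 1 - j%:Z - i%:Z) = - binz K (- 1 - i%:Z) j.
Proof.
rewrite !binzN_bin.
have -> : (- 1 : K) ^ (- 1 - j%:Z - i%:Z) = (- 1) ^+ (i + j).+1.
  have -> : - 1 - j%:Z - i%:Z = - (i + j).+1%:Z by lia.
  by rewrite -exprz_inv invrN1.
have -> : 'C(j + i, j) = 'C(i + j, i).
  by rewrite addnC -(bin_sub (leq_addl i j)) addnK.
have -> : (- 1) ^+ (i + j).+1 = - ((- 1) ^+ i * (- 1) ^+ j) :> K.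
  by rewrite exprS exprD mulN1r.
have /(congr1 (fun x : K => x * (- 1) ^+ j * 'C(i + j, i)%:R)) :
  (- 1) ^+ i * (- 1) ^+ i = 1 :> K by rewrite -expr2 sqrr_sign.
rewrite mul1r => <-; ring.
Qed.

Lemma izw_poly (k : nat) : izw K k%:Z = series_of_poly (zBw K ^+ k).
Proof.
apply/funext => p; apply/funext => q.
have coefE (m n : nat) : ((zBw K ^+ k)`_m)`_n =
    if m%:Z == k%:Z - n%:Z then 'C(k, n)%:R * (- 1) ^+ n else 0.
  have -> : zBw K ^+ k = \sum_(i < k.+1)
      'X^(k - i) * (('C(k, i)%:R * (- 1) ^+ i) *: 'X^i)%:P.
    rewrite /zBw exprBn; apply: eq_bigr => i _.
    rewrite -mul_polyC !rmorphM /= !rmorph_nat !rmorph_sign !rmorphXn -mulr_natl /=.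
    by ring.
  rewrite coef_sum coef_sum.
  under eq_bigr => i _ do rewrite coefMC coefXn mulr_natl coefMn coefZ coefXn.
  case: (leqP n k) => [nk|kn]; last first.
    rewrite big1 => [|i _]; last first.
      have -> : n == i = false by have := ltn_ord i; lia.
      by rewrite mulr0 mul0rn.
    by case: eqP => //; lia.
  rewrite (bigD1 (inord n)) //= inordK // eqxx mulr1 big1 => [|i ni].
    rewrite addr0; have -> : (m == (k - n)%N) = (m%:Z == k%:Z - n%:Z) by lia.
    by case: eqP => _; rewrite ?mulr1n ?mulr0n.
  have -> : n == i = false.
    by apply/negbTE; apply: contraNneq ni => ->; rewrite inord_val.
  by rewrite mulr0 mul0rn.
case: p => [m|m]; case: q => [n|n] //=; rewrite binz_bin ?coefE //.
by case: eqP => // kn; rewrite bin_small ?mul0r //; lia.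
Qed.

(** Exchanging i with k - i; the terms beyond i = k vanish on either side. *)
Lemma iwz_izw_nat (k : nat) : iwz K k%:Z = izw K k%:Z.
Proof.
apply/funext => p; apply/funext => q.
case: p => [m|m]; case: q => [n|n] //=; rewrite ?binz_bin.
- case: eqP => h1; case: eqP => h2 //; try lia.
  have mk : (m <= k)%N by lia.
  by rewrite -h1 -(bin_sub mk); congr ('C(_, _)%:R * _); lia.
- by case: eqP => // kn; rewrite bin_small ?mul0r //; lia.
- by case: eqP => // kn; rewrite bin_small ?mul0r //; lia.
Qed.
End BinomialSeries.

(** * Coefficients of residues and of normal products *)

Section FormalDistributionCoefficients.
Context {K : numFieldType} {V : lmodType K} {G : super_grading V}.

(** The scalar is the falling product (m+j)(m+j-1)...(m+1), written through a
    binomial coefficient so as to match the expansions after division by j!. *)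
Lemma coeff_iter_fderiv (j : nat) (a : fdist G) (m : int) :
  coeff (iter j (@fderiv _ _ G) a) m =
  (j`!%:R * binz K (m + j%:Z) j) *: a (m + j%:Z).
Proof.
rewrite /binz mulrC divfK ?fact_neq0 //.
elim: j m => [|j IHj] m; first by rewrite big_ord0 addr0 scale1r.
rewrite iterS /= IHj scalerA big_ord_recr /= mulrC.
have -> : m + 1 + j%:Z = m + j.+1%:Z by lia.
by congr (_ * _%:~R *: _); lia.
Qed.

Lemma parity_iter_fderiv (j : nat) (a : fdist G) :
  parity (iter j (@fderiv _ _ G) a) = parity a.
Proof. by elim: j. Qed.

(** The support of the expansion is one antidiagonal, parametrized by the
    exponent i of w; taking z^-1 then fixes the exponent of z in A. *)
Lemma res_smul_izw (k : int) (A : int -> int -> End V) (n : int) :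
  res (smul (izw K k) A) n =
  lfsum (fun i : nat => (binz K k i * (- 1) ^+ i) *: A (i%:Z - k - 1) (n - i%:Z)).
Proof.
rewrite /res /smul (@lfsum_reindex _ _ _ _ (fun i : nat => (k - i%:Z, i%:Z))).
- by apply: eq_lfsum => i /=; rewrite eqxx; congr (_ *: A _ _); lia.
- by move=> s t [_ ->].
move=> [p [i|i]] /= gi; last by rewrite scale0r.
case: eqP => [pE|_]; last by rewrite scale0r.
by have := gi i; rewrite pE eqxx.
Qed.

Lemma res_smul_iwz (k : int) (A : int -> int -> End V) (n : int) :
  res (smul (iwz K k) A) n =
  lfsum (fun i : nat =>
    (binz K k i * (- 1) ^ (k - i%:Z)) *: A (- 1 - i%:Z) (n - k + i%:Z)).
Proof.
rewrite /res /smul (@lfsum_reindex _ _ _ _ (fun i : nat => (i%:Z, k - i%:Z))).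
- by apply: eq_lfsum => i /=; rewrite eqxx; congr (_ *: A _ _); lia.
- by move=> s t [->].
move=> [[i|i] q] /= gi; last by rewrite scale0r.
case: eqP => [qE|_]; last by rewrite scale0r.
by have := gi i; rewrite qE eqxx.
Qed.

(** Cauchy's formula for the part of a(z) with nonnegative powers of z: term by
    term, the mode of a(z) met by w^i in the expansion is the coefficient of
    z^(i+j). *)
Lemma dmul_plus_fderiv (j : nat) (a b : fdist G) (n : int) :
  (j`!%:R)^-1 *: dmul (plus_part (iter j (@fderiv _ _ G) a)) b n =
  res (smul (izw K (- 1 - j%:Z)) (prod_zw a b)) n.
Proof.
rewrite res_smul_izw /dmul (@lfsum_reindex _ _ _ _ Posz); first last.
- move=> [i|i] gi; first by have := gi i; rewrite eqxx.
  by rewrite /plus_part /= mul0r.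
- by move=> s t [].
rewrite -lfsumZ; apply: eq_lfsum => i /=.
rewrite /plus_part /= coeff_iter_fderiv End_scaleAl scalerA.
rewrite mulrA mulVf ?fact_neq0 // mul1r binzN_shift /prod_zw.
by congr (_ *: (a _ * _)); lia.
Qed.

(** Cauchy's formula for the negative powers: z^i in the expansion meets the
    coefficient of z^(-1-i) in a(z), which the derivative moves to the exponent
    -1-j-i. *)
Lemma dmul_minus_fderiv (j : nat) (a b : fdist G) (n : int) :
  (j`!%:R)^-1 *: dmul b (minus_part (iter j (@fderiv _ _ G) a)) n =
  - res (smul (iwz K (- 1 - j%:Z)) (prod_wz b a)) n.
Proof.
(* The index of the coefficient of b(w) paired with exponent -1-j-i. *)
pose g (i : nat) := n + 1 + j%:Z + i%:Z.
rewrite res_smul_iwz /dmul (@lfsum_reindex _ _ _ _ g); first last.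
- (* The exponents -j, ..., -1 are missed by g; there the derivative vanishes,
     as it kills w^0, ..., w^(j-1). *)
  move=> k gk; rewrite /minus_part; case: ifP => [nk|_]; last by rewrite mulr0.
  rewrite coeff_iter_fderiv.
  case E : (n - k + j%:Z) => [m|m]; last first.
    by have /eqP[] := gk m; rewrite /g; lia.
  by rewrite binz_bin bin_small ?mulr0 ?scale0r ?mulr0 //; lia.
- by move=> s t; rewrite /g; lia.
rewrite -lfsumZ -scaleN1r -lfsumZ; apply: eq_lfsum => i /=.
rewrite /minus_part; have -> : n - g i < 0 by rewrite /g; lia.
rewrite coeff_iter_fderiv End_scaleAr scalerA.
rewrite mulrA mulVf ?fact_neq0 // mul1r binzN_reflect scaleN1r scaleNr opprK.
have -> : n - g i + j%:Z = - 1 - i%:Z by rewrite /g; lia.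
by rewrite /prod_wz; congr (_ *: (b _ * _)); rewrite /g; lia.
Qed.

(** A polynomial has finitely many terms, so its product with any series is
    locally finite and additive in the series. *)
Lemma smulB_poly (P : {poly {poly K}}) (A B : int -> int -> End V) :
  smul (series_of_poly P) A - smul (series_of_poly P) B =
  smul (series_of_poly P) (A - B).
Proof.
apply/funext => m; apply/funext => n.
rewrite /smul -[RHS]/(lfsum _) -[LHS]/(lfsum _ - lfsum _).
rewrite -lfsumB; [|exact: poly_loc_finite..].
by apply: eq_lfsum => r; rewrite -scalerBr.
Qed.

Lemma smul_scale (f : int -> int -> K) (c : K) (A : int -> int -> End V) m n :
  smul f (c *: A) m n = c *: smul f A m n.
Proof.
rewrite /smul -lfsumZ; apply: eq_lfsum => r.
by rewrite -[(c *: A) _ _]/(c *: A _ _) !scalerA mulrC.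
Qed.

End FormalDistributionCoefficients.

Theorem proposition3p4p3 (R : realType) (V : lmodType R[i])
    (G : super_grading V) (a b : fdist G)
    (ha : is_field a) (hb : is_field b) (j : nat) :
  jprod a j%:Z b =
    res (smul (series_of_poly (zBw R[i] ^+ j)) (bracket_zw a b))
  /\ jprod a (- 1 - j%:Z) b =
    (j`!%:R : R[i])^-1 *: nprod (iter j (@fderiv _ _ G) a) b.
Proof.
split; first by rewrite /jprod iwz_izw_nat izw_poly smulB_poly.
apply/funext => n.
rewrite /jprod /nprod parity_iter_fderiv.
rewrite -[RHS]/(_ *: (dmul (plus_part _) b n + koszul _ _ _ *: dmul b (minus_part _) n)).
rewrite scalerDr scalerA mulrC -scalerA dmul_plus_fderiv dmul_minus_fderiv scalerN.
by rewrite -[LHS]/(res _ n - _) smul_scale.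
Qed.
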